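(* Let $\mathbf{X}\subseteq\mathrm{Reg}$ be effectively polynomially bounded (represented by the restriction of the identity). For $f:\mathbf{X}\to\mathrm{Reg}$ the following are equivalent: (1) $f$ is polytime-locally uniformly continuous; (2) $f\in\mathcal{C}^{T=P_2}(\mathbf{X},\mathrm{Reg})$, i.e. $f$ has a name in $\mathcal{C}^{T=P_2}(\mathbf{X},\mathrm{Reg})$.
   Context: Fix a finite alphabet $\Sigma$. A total $\varphi:\Sigma^*\to\Sigma^*$ is regular if $|u|\le|v|$ implies $|\varphi(u)|\le|\varphi(v)|$; size $|\varphi|(|u|)=|\varphi(u)|$. $\mathrm{mon}$: strictly monotone functions $\mathbb{N}\to\mathbb{N}$; $\mathrm{Reg}$: regular $\varphi$ with $|\varphi|\in\mathrm{mon}$; $\mathrm{Reg}$ is a represented space via the identity. A polynomial-time string pairing $\langle\cdot,\cdot\rangle$ with $|\langle u,v\rangle|=|u|\cdot|v|$ is lifted pointwise to $\mathrm{Reg}$ and to tuple/mixed pairings. Second-order polynomials in $\mathtt{L}$, $\mathtt{n}$ are built from positive integers and $\mathtt{n}$ via $+,\cdot,\mathtt{L}(\cdot)$. A machine computes $F:\subseteq\mathrm{Reg}\to\mathrm{Reg}$ if on oracle $\varphi\in\mathrm{dom}F$, input $u$ it outputs $F(\varphi)(u)$; it is polynomial-time if for some second-order polynomial $P$ it halts within $P(|\varphi|)(|u|)$ steps for all oracles and inputs. $\mathbb{N}$ is represented by $\delta_{\mathbb{N}}(\varphi)=|\varphi(0)|$. $P_0(p)(k)=k$, $P_{j+1}(p)(k)=p(P_j(p)(k))$.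 Clocked machine $M^{T=P_m}$: a fixed efficiently simulating universal oracle machine $M$ (simulating the $n$-th oracle machine in time quadratic in $n$ and the simulated time) extended by a clock which, on index $n$, oracle $\varphi'$, parameter $l$ and input $w$, aborts once simulation time exceeds $P_m(|\langle n,\varphi'\rangle|)(|w|^l)$. In $\mathcal{C}^{T=P_m}(\mathbf{X},\mathbf{Y})$ a (suitably encoded) triple $\langle n,\psi,x^l\rangle$ names $f$ iff $\varphi\mapsto M^{T=P_m}(\langle n,\langle\varphi,\psi\rangle,x^l\rangle)$ realizes $f$. $\mathbf{X}$ is effectively polynomially bounded (epb) iff it admits a $\mathrm{Reg}$-representation $\delta_X$ with $c\in\mathbb{N}$ and a monotone polynomial $Q$ such that $|\varphi|(i)\le c\,|\varphi|(c)^c\,Q(i)$ for all $\varphi\in\mathrm{dom}\delta_X$, $i\in\mathbb{N}$. A partial $g:\subseteq\mathrm{Reg}\to\mathrm{Reg}$ is uniformly continuous if there is $\lambda:\mathbb{N}\to\mathbb{N}$ such that for all $\varphi$ in its domain and strings $u$, $g(\varphi)(u)$ depends only on the values $\varphi(w)$ with $|w|\le\lambda(|u|)$. A partial $f:\subseteq\mathrm{Reg}\to\mathrm{Reg}$ is polytime-locally uniformly continuous if there is a polynomial-time computable $\chi:\subseteq\mathrm{Reg}\to\mathbb{N}$ with $\mathrm{dom}(f)\subseteq\mathrm{dom}(\chi)$ such that each restriction $f|_{\chi^{-1}(\{n\})}$ is uniformly continuous.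
   Formalization: The pairing has length (|u|+2)(|v|+2), as no injective pairing of length |u||v| exists; the clock uses (|w|+2)^l instead of |w|^l, since otherwise (1)⇒(2) fails for |w|≤1; the alphabet has at least two letters. *)

(* Defs.v *)
(* Mathematical Components world *)
From mathcomp Require Import all_boot all_order all_algebra zify.
Set Implicit Arguments. Unset Strict Implicit. Unset Printing Implicit Defensive.

(* A finite alphabet with two distinguished letters; a one-letter alphabet
   admits no pairing of the kind used below. *)
Record alphabet := Alphabet {
  letter :> finType;
  zero : letter;
  one : letter;
  zero_neq_one : zero != one }.

Definition str (A : alphabet) : Type := seq A.

(* |phi|; it does not depend on the strings used to probe the length when phi
   is regular, see [size_reg]. *)
Definition fsize (A : alphabet) (phi : str A -> str A) (k : nat) : nat :=
  size (phi (nseq k (zero A))).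

Record Reg (A : alphabet) := MkReg {
  reg_fun :> str A -> str A;
  reg_regular : forall u v, size u <= size v -> size (reg_fun u) <= size (reg_fun v);
  reg_mon : forall i j, i < j -> fsize reg_fun i < fsize reg_fun j }.

Lemma size_reg (A : alphabet) (phi : Reg A) (u : str A) :
  size (phi u) = fsize phi (size u).
Proof.
by apply/eqP; rewrite eqn_leq /fsize; apply/andP; split;
  apply: reg_regular; rewrite size_nseq.
Qed.

(* Each letter is preceded by the marker [one]; the end is marked by
   [zero; zero]. *)
Definition mark (A : alphabet) (u : str A) : str A :=
  flatten [seq [:: one A; a] | a <- u] ++ [:: zero A; zero A].

(* No injective pairing satisfies |<u,v>| = |u| * |v| (for instance <[::],v>
   would always be empty), so both factors are shifted by 2, see [size_spair]:
   this is the smallest shift for which the two-letter alphabet has room.  The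
   first component comes first, so that it can be read off in time linear in
   its own length. *)
Definition spair (A : alphabet) (u v : str A) : str A :=
  mark u ++ mark v ++ nseq (size u * size v) (zero A).

Lemma size_mark (A : alphabet) (u : str A) : size (mark u) = (size u).*2 + 2.
Proof.
rewrite /mark size_cat /=; congr (_ + _).
by elim: u => //= a u ->; rewrite doubleS.
Qed.

Lemma size_spair (A : alphabet) (u v : str A) :
  size (spair u v) = (size u + 2) * (size v + 2).
Proof.
rewrite /spair size_cat size_mark size_cat size_mark size_nseq.
rewrite mulnDl !mulnDr -!muln2; lia.
Qed.

Lemma mark_cat_inj (A : alphabet) (u v s t : str A) :
  mark u ++ s = mark v ++ t -> u = v /\ s = t.
Proof.
elim: u v => [|a u IH] [|b v] //=.
- by case.
- by case=> e; move: (zero_neq_one A); rewrite e eqxx.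
- by case=> e; move: (zero_neq_one A); rewrite e eqxx.
- by case=> -> /IH [-> ->].
Qed.

Lemma spair_inj (A : alphabet) (u v u' v' : str A) :
  spair u v = spair u' v' -> u = u' /\ v = v'.
Proof. by move=> /mark_cat_inj [-> /mark_cat_inj [->]]. Qed.

Section Pairing.
Variable A : alphabet.

Section FunFun.
Variables phi psi : Reg A.
Let pp (u : str A) : str A := spair (phi u) (psi u).

Fact rpair_regular u v : size u <= size v -> size (pp u) <= size (pp v).
Proof. by move=> le; rewrite !size_spair leq_mul // leq_add2r reg_regular. Qed.

Fact rpair_mon i j : i < j -> fsize pp i < fsize pp j.
Proof.
move=> lt; rewrite /fsize !size_spair ltn_mul //.
  by rewrite ltn_add2r; exact: reg_mon.
by rewrite ltn_add2r; exact: reg_mon.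
Qed.

Definition rpair : Reg A := MkReg rpair_regular rpair_mon.
End FunFun.

Section StrFun.
Variables (v : str A) (phi : Reg A).
Let pp (u : str A) : str A := spair v (phi u).

Fact spair_reg_regular u w : size u <= size w -> size (pp u) <= size (pp w).
Proof. by move=> le; rewrite !size_spair leq_mul // leq_add2r reg_regular. Qed.

Fact spair_reg_mon i j : i < j -> fsize pp i < fsize pp j.
Proof.
move=> lt; rewrite /fsize !size_spair ltn_pmul2l ?addn2 // !ltnS; exact: reg_mon.
Qed.

Definition spair_reg : Reg A := MkReg spair_reg_regular spair_reg_mon.
End StrFun.

(* <n, phi>, a number being written in unary, in accordance with the
   representation [NatSpace] of nat. *)
Definition npair (n : nat) (phi : Reg A) : Reg A := spair_reg (nseq n (zero A)) phi.
End Pairing.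

(** ** Represented spaces *)

Record rspace (A : alphabet) := RSpace {
  point :> Type;
  rdom : Reg A -> Prop;
  delta : {phi : Reg A | rdom phi} -> point;
  delta_surj : forall x, exists p, delta p = x }.

(* Represented by the restriction of the identity. *)
Definition subspace (A : alphabet) (X : Reg A -> Prop) : rspace A :=
  @RSpace A {phi : Reg A | X phi} X (fun p => p) (fun x => ex_intro _ x erefl).

Definition RegSpace (A : alphabet) : rspace A :=
  @RSpace A (Reg A) (fun _ => True) (@proj1_sig _ _)
    (fun x => ex_intro _ (exist (fun _ => True) x I) erefl).

Section NatSpace.
Variable A : alphabet.
Let pad (n : nat) (u : str A) : str A := nseq (n + size u) (zero A).

Fact pad_regular n u v : size u <= size v -> size (pad n u) <= size (pad n v).
Proof. by rewrite /pad !size_nseq leq_add2l. Qed.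

Fact pad_mon n i j : i < j -> fsize (pad n) i < fsize (pad n) j.
Proof. by rewrite /fsize /pad !size_nseq ltn_add2l. Qed.

(* The argument 0 of the name is the string of length 0; with a string of
   positive length the number 0 would have no name. *)
Definition delta_nat (p : {phi : Reg A | True}) : nat := size (proj1_sig p [::]).

Fact delta_nat_surj n : exists p, delta_nat p = n.
Proof.
exists (exist (fun _ => True) (MkReg (@pad_regular n) (@pad_mon n)) I).
by rewrite /delta_nat /pad /= size_nseq addn0.
Qed.

Definition NatSpace : rspace A := RSpace delta_nat_surj.
End NatSpace.

(* Effectively polynomially bounded. *)
Definition epb (A : alphabet) (X : rspace A) : Prop :=
  exists (c : nat) (Q : {poly int}),
    (forall i j : nat, i <= j -> (Q.[i%:Z] <= Q.[j%:Z])%R) /\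
    (forall phi : Reg A, rdom X phi -> forall i : nat,
       ((fsize phi i)%:Z <= c%:Z * (fsize phi c)%:Z ^+ c * Q.[i%:Z])%R).

(** ** Second-order polynomials *)

Inductive sopoly : Type :=
| SConst of nat  (* [SConst c] denotes the positive integer c.+1 *)
| SVar
| SAdd of sopoly & sopoly
| SMul of sopoly & sopoly
| SApp of sopoly.

Fixpoint sopoly_eval (P : sopoly) (L : nat -> nat) (n : nat) : nat :=
  match P with
  | SConst c => c.+1
  | SVar => n
  | SAdd P1 P2 => sopoly_eval P1 L n + sopoly_eval P2 L n
  | SMul P1 P2 => sopoly_eval P1 L n * sopoly_eval P2 L n
  | SApp P1 => L (sopoly_eval P1 L n)
  end.

(** ** Oracle Turing machines *)

Section Machines.
Variable A : alphabet.

(* One-way infinite tape; [None] is the blank, and all cells beyond [cells]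
   are blank. *)
Record tape := Tape { cells : seq (option A); head : nat }.

Inductive move := MoveL | Stay | MoveR.

Definition tape_of (u : str A) : tape := Tape [seq Some a | a <- u] 0.

Definition tape_read (t : tape) : option A := nth None (cells t) (head t).

Definition tape_act (xd : option A * move) (t : tape) : tape :=
  let: (x, d) := xd in
  Tape (set_nth None (cells t) (head t) x)
    (match d with MoveL => (head t).-1 | Stay => head t | MoveR => (head t).+1 end).

(* The string written from cell 0 up to the first blank. *)
Definition content (t : tape) : str A :=
  pmap id (take (index None (cells t)) (cells t)).

(* Tape 0 holds the input and finally the output; tape 1 is the query tape,
   tape 2 the answer tape; [work] further tapes.  A state q with
   [call q = Some q'] is a query state, whose computation resumes in q'. *)
Record machine := Machine {
  work : nat;
  state : finType;
  start : state;
  final : pred state;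
  call : state -> option state;
  trans : state -> {ffun 'I_work.+3 -> option A} ->
          state * ('I_work.+3 -> option A * move) }.

Record config (M : machine) := Config {
  cstate : state M;
  ctape : 'I_(work M).+3 -> tape }.

Definition io_tape (k : nat) : 'I_k.+3 := @Ordinal k.+3 0 isT.
Definition query_tape (k : nat) : 'I_k.+3 := @Ordinal k.+3 1 isT.
Definition answer_tape (k : nat) : 'I_k.+3 := @Ordinal k.+3 2 isT.

(* A query takes one step, whatever the length of the answer.  It empties the
   query tape: an answer must be copied before it can be part of a new query,
   so that t steps never lead to a query longer than t. *)
Definition step (M : machine) (phi : str A -> str A) (c : config M) : config M :=
  let: Config q ts := c in
  if final q then c
  else if call q is Some q' then
    Config q' (fun i =>
      if i == query_tape _ then tape_of [::]
      else if i == answer_tape _ then tape_of (phi (content (ts (query_tape _))))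
      else ts i)
  else
    let: (q', act) := trans q [ffun i => tape_read (ts i)] in
    Config q' (fun i => tape_act (act i) (ts i)).

Definition init (M : machine) (u : str A) : config M :=
  Config (start M) (fun i => tape_of (if i == io_tape _ then u else [::])).

(* [Some v] iff M halts within t steps on oracle phi and input u with output v. *)
Definition run (M : machine) (phi : str A -> str A) (u : str A) (t : nat) :
    option (str A) :=
  let c := iter t (step phi) (init M u) in
  if final (cstate c) then Some (content (ctape c (io_tape _))) else None.

Definition polytime (M : machine) : Prop :=
  exists P : sopoly, forall (phi : Reg A) (u : str A),
    run M phi u (sopoly_eval P (fsize phi) (size u)) <> None.

(* Polynomial-time computability of a partial function between represented
   spaces, D being its domain. *)
Definition polytime_computable (X Y : rspace A) (D : X -> Prop)
    (f : {x : X | D x} -> Y) : Prop :=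
  exists M : machine, polytime M /\
    forall (p : {phi : Reg A | rdom X phi}) (h : D (delta p)),
    exists q : {psi : Reg A | rdom Y psi},
      (forall u, exists t, run M (proj1_sig p) u t = Some (proj1_sig q u)) /\
      delta q = f (exist D (delta p) h).

(** ** Clocked universal machine *)

(* A numbering of all oracle machines together with an oracle machine
   simulating the n-th one on oracle phi, when given the oracle <n, phi>. *)
Record universal := Universal {
  nth_machine : nat -> machine;
  nth_machine_complete : forall M : machine, exists n,
    forall (phi : Reg A) (w : str A) (t : nat),
      run (nth_machine n) phi w t = run M phi w t;
  umachine : machine;
  uconst : nat;
  umachine_sound : forall n (phi : Reg A) (w : str A) t v,
    run umachine (npair n phi) w t = Some v ->
    exists t', run (nth_machine n) phi w t' = Some v;
  umachine_quadratic : forall n (phi : Reg A) (w : str A) t v,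
    run (nth_machine n) phi w t = Some v ->
    run umachine (npair n phi) w (uconst * (n.+1 * t.+1) ^ 2) = Some v }.

(* The universal machine with time bound P_m(|<n, phi>|)(|w|^l), where
   P_m(p) is the m-th iterate of p; [None] if the computation is aborted.  As
   in the pairing, |w| is shifted by 2: otherwise |w|^l would not depend on l
   when |w| = 1, and would vanish for all l > 0 when |w| = 0. *)
Definition clocked (U : universal) (m n : nat) (phi : Reg A) (l : nat)
    (w : str A) : option (str A) :=
  run (umachine U) (npair n phi) w
    (iter m (fsize (npair n phi)) ((size w + 2) ^ l)).

(* (n, psi, l) is a name of f in C^{T = P_m}(X, Y). *)
Definition names_fun (U : universal) (m : nat) (X Y : rspace A)
    (n : nat) (psi : Reg A) (l : nat) (f : X -> Y) : Prop :=
  forall p : {phi : Reg A | rdom X phi},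
  exists q : {phi : Reg A | rdom Y phi},
    (forall w, clocked U m n (rpair (proj1_sig p) psi) l w = Some (proj1_sig q w)) /\
    delta q = f (delta p).

Definition in_CT (U : universal) (m : nat) (X Y : rspace A) (f : X -> Y) : Prop :=
  exists (n : nat) (psi : Reg A) (l : nat), names_fun U m n psi l f.

(** ** Continuity of partial functions on Reg *)

Definition uniformly_continuous (D : Reg A -> Prop)
    (g : {phi : Reg A | D phi} -> Reg A) : Prop :=
  exists lam : nat -> nat,
    forall (p q : {phi : Reg A | D phi}) (u : str A),
      (forall w, size w <= lam (size u) -> proj1_sig p w = proj1_sig q w) ->
      g p u = g q u.

Definition restrict (D : Reg A -> Prop) (g : {phi : Reg A | D phi} -> Reg A)
    (S : Reg A -> Prop) : {phi : Reg A | D phi /\ S phi} -> Reg A :=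
  fun p => g (exist D (proj1_sig p) (proj1 (proj2_sig p))).

Arguments restrict [D] g S p.

Definition polytime_locally_uc (D : Reg A -> Prop)
    (f : {phi : Reg A | D phi} -> Reg A) : Prop :=
  exists (E : Reg A -> Prop) (chi : {phi : Reg A | E phi} -> nat),
    [/\ @polytime_computable (RegSpace A) (NatSpace A) E chi,
        forall phi, D phi -> E phi &
        forall n, uniformly_continuous
          (restrict f (fun phi => exists h : E phi, chi (exist E phi h) = n))].

End Machines.

(* Main.v *)
(* Both sides say that, for the constant c of the polynomial bound and some
   function lam, the string f(phi)(u) depends only on the number a = |phi|(c)
   and on phi restricted to strings of length <= lam(a)(|u|).  If f is
   polytime-locally uniformly continuous, or if it has a name, this holds
   because t steps of a machine only see oracle values on strings of length
   <= t, and because the polynomial bound turns every time bound involving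
   |phi| into a function of a.

   Conversely, such a lam makes f uniformly continuous on each fibre of
   phi |-> |phi|(c), which is computable in polynomial time.  To get a name, let
   the oracle psi do the thinking: a fixed machine sends psi the transcript of
   all values of phi seen so far, and psi replies either with the next string at
   which phi is to be probed or with the result.  The running time of this
   dialog depends on a and |w| only, and not on |psi|, so psi can be padded to
   a length exceeding it.  With L = |<n, <phi, psi>>| and K = (|w| + 2)^(c+1) we
   have L(K) >= a and L(K) >= |w|, so the time L(L(K)) >= |psi|(L(K)) suffices:
   this is where the second iterate is needed. *)
Require Import Defs.
From mathcomp Require Import all_boot all_order all_algebra.
From HB Require Import structures.
From mathcomp Require Import boolp zify.
Set Implicit Arguments. Unset Strict Implicit. Unset Printing Implicit Defensive.

(** * Runs of machines *)

Section Runs.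
Variables (A : alphabet) (M : machine A).
Implicit Types (phi : str A -> str A) (u v : str A).

Lemma run_leq phi u v t t' :
  run M phi u t = Some v -> t <= t' -> run M phi u t' = Some v.
Proof.
move=> h /subnKC <-; move: h; rewrite /run addnC iterD.
case: ifP => // fin <-; set d := t' - t.
suff -> : iter d (@step A M phi) (iter t (@step A M phi) (init M u)) =
          iter t (@step A M phi) (init M u) by rewrite fin.
elim: d => //= d ->; move: fin.
by case: (iter t _ _) => q ts /= ->.
Qed.

Lemma run_fun phi u v v' t t' :
  run M phi u t = Some v -> run M phi u t' = Some v' -> v = v'.
Proof.
by case/orP: (leq_total t t') => le h h';
  [move: (run_leq h le) | move: (run_leq h' le)]; congruence.
Qed.

Lemma size_content (t : tape A) : size (content t) <= size (cells t).
Proof.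
rewrite /content size_pmap (leq_trans (count_size _ _)) //.
by rewrite size_take_min geq_minr.
Qed.

(** A step adds at most one cell to a tape, and a query empties the query tape. The answer tape is
    excluded because a single query can fill it with a string of any length. *)
Lemma iter_step_bound phi u t (i : 'I_(work M).+3) :
  let c := iter t (@step A M phi) (init M u) in
  i != answer_tape _ ->
  Defs.head (ctape c i) <= t /\
  size (cells (ctape c i)) <= (if i == io_tape _ then size u else 0) + t.
Proof.
move=> /= ni; elim: t => [|t [IH1 IH2]] /=.
  by rewrite size_map; split=> //; case: ifP; rewrite ?addn0.
case: (iter t _ _) IH1 IH2 => q ts /= IH1 IH2.
case: ifP => _ /=; first by lia.
case: (call q) => [q'|].
  rewrite /= (negbTE ni); case: ifP => _ //=; lia.
case: (trans q _) => q' act /=; case: (act i) => x d /=.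
rewrite size_set_nth; split; last by lia.
by case: d => /=; lia.
Qed.

(** A query made in step [t.+1] has length at most [t], by the bound on the query tape. *)
Lemma iter_step_local phi phi' u t :
  (forall w, size w <= t -> phi w = phi' w) ->
  iter t (@step A M phi) (init M u) = iter t (@step A M phi') (init M u).
Proof.
elim: t => // t IH agree; rewrite !iterS -IH; last first.
  by move=> w le; rewrite agree // leqW.
have [_] := @iter_step_bound phi u t (query_tape _) isT.
case: (iter t _ _) => q ts /= le.
case: ifP => // _; case: (call q) => // q'; rewrite agree //.
by rewrite (leq_trans (size_content _)) // leqW.
Qed.

Lemma run_local phi phi' u t :
  (forall w, size w <= t -> phi w = phi' w) -> run M phi u t = run M phi' u t.
Proof. by move=> agree; rewrite /run (iter_step_local _ agree). Qed.

Lemma size_run phi u v t : run M phi u t = Some v -> size v <= size u + t.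
Proof.
rewrite /run; case: ifP => // _ [<-].
by rewrite (leq_trans (size_content _)) //; case: (@iter_step_bound phi u t (io_tape _)).
Qed.

End Runs.

Section Bounds.
Variable A : alphabet.

Lemma leq_fsize (phi : Reg A) i j : i <= j -> fsize phi i <= fsize phi j.
Proof. by move=> le; apply: reg_regular; rewrite !size_nseq. Qed.

Lemma fsize_ge (phi : Reg A) i : i <= fsize phi i.
Proof. by elim: i => // i IH; rewrite (leq_ltn_trans IH) // reg_mon. Qed.

Lemma leq_sopoly_eval (P : sopoly) (L L' : nat -> nat) n :
  (forall i, L i <= L' i) -> {homo L' : i j / i <= j} ->
  sopoly_eval P L n <= sopoly_eval P L' n.
Proof.
move=> le mon; elim: P => //= [P1 h1 P2 h2|P1 h1 P2 h2|P h].
- exact: leq_add.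
- exact: leq_mul.
- exact: leq_trans (le _) (mon _ _ h).
Qed.

(** The absolute value turns the integer bound into a natural number, and the running maximum makes
    it monotone in [i]. *)
Lemma epb_bound (X : rspace A) : epb X ->
  exists (c : nat) (b : nat -> nat -> nat),
    (forall a, {homo b a : i j / i <= j}) /\
    (forall phi : Reg A, rdom X phi -> forall i, fsize phi i <= b (fsize phi c) i).
Proof.
case=> c [Q [_ hQ]]; exists c.
pose B (a i : nat) : nat := absz (c%:Z * a%:Z ^+ c * Q.[i%:Z])%R.
exists (fun a i => \max_(j < i.+1) B a j); split=> [a i j le|phi hphi i].
  apply/bigmax_leqP => k _.
  have lt : k < j.+1 by rewrite (leq_trans (ltn_ord k)).
  exact: (leq_bigmax (Ordinal lt)).
apply: leq_trans (leq_bigmax (F := fun j : 'I_i.+1 => B _ j) ord_max).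
by have := hQ _ hphi i; rewrite /B /=; lia.
Qed.

End Bounds.

(** * Local moduli, obtained from either side of the equivalence *)

Section LocalModulus.
Variables (A : alphabet) (X : Reg A -> Prop) (f : {phi : Reg A | X phi} -> Reg A).

Definition local_modulus (c : nat) (lam : nat -> nat -> nat) : Prop :=
  forall (x y : {phi : Reg A | X phi}) (u : str A),
    fsize (proj1_sig x) c = fsize (proj1_sig y) c ->
    (forall w, size w <= lam (fsize (proj1_sig x) c) (size u) ->
       proj1_sig x w = proj1_sig y w) ->
    f x u = f y u.

Variables (c : nat) (b : nat -> nat -> nat).
Hypothesis b_mono : forall a, {homo b a : i j / i <= j}.
Hypothesis bP : forall phi : Reg A, X phi -> forall i, fsize phi i <= b (fsize phi c) i.

(** Write [a] for |phi|(c). On the empty input, [chi] is computed within [B a] steps. So agreement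
    up to length [B a] forces equal values of [chi], and these are at most [B a]. For each [a] only
    finitely many fibres occur, and the maximum of their moduli serves for all of them. *)
Lemma polytime_locally_uc_modulus :
  polytime_locally_uc f -> exists lam, local_modulus c lam.
Proof.
case=> E [chi [[M [[P hP] hM]] DE uc]].
have [lam lamP] := choice uc.
pose B a := sopoly_eval P (b a) 0.
exists (fun a k => B a + \max_(m < (B a).+1) lam m k) => x y u eqa agree.
have chiE (z : {phi : Reg A | X phi}) : exists2 v,
    run M (proj1_sig z) [::] (B (fsize (proj1_sig z) c)) = Some v &
    forall h : E (proj1_sig z), chi (exist _ _ h) = size v.
  case: z => phi hphi /=.
  have le := @leq_sopoly_eval P (fsize phi) (b (fsize phi c)) 0 (bP hphi) (@b_mono _).
  case rE: (run M phi [::] (sopoly_eval P (fsize phi) 0)) => [v|]; last by case: (hP phi [::]).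
  exists v => [|h]; first exact: run_leq rE le.
  have [q [hq <-]] := hM (exist (fun _ => True) phi I) h.
  have [t ht] := hq [::].
  by rewrite /= /delta_nat (run_fun ht rE).
have [v rx cx] := chiE x; have [v' ry cy] := chiE y.
have vE : v' = v.
  move: rx; rewrite eqa (@run_local _ _ _ (proj1_sig y)); first by rewrite ry => -[].
  by rewrite -eqa => w le; apply: agree; rewrite (leq_trans le) // leq_addr.
have lev : size v < (B (fsize (proj1_sig x) c)).+1 by rewrite ltnS (leq_trans (size_run rx)).
case: x y {chiE} eqa agree cx cy rx ry lev => [phi hphi] [phi' hphi'] /= eqa agree cx cy rx ry lev.
have S1 : X phi /\ exists h : E phi, chi (exist E phi h) = size v.
  by split=> //; exists (DE _ hphi).
have S2 : X phi' /\ exists h : E phi', chi (exist E phi' h) = size v.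
  by split=> //; exists (DE _ hphi'); rewrite cy vE.
have := lamP (size v) (exist _ phi S1) (exist _ phi' S2) u.
rewrite /restrict /=.
rewrite (Prop_irrelevance (proj1 S1) hphi) (Prop_irrelevance (proj1 S2) hphi').
apply=> w le; apply: agree; rewrite (leq_trans le) //.
by rewrite (leq_trans _ (leq_addl _ _)) // (leq_bigmax (Ordinal lev)).
Qed.

Lemma in_CT_modulus (U : universal A) m :
  @in_CT A U m (subspace X) (RegSpace A) f -> exists lam, local_modulus c lam.
Proof.
case=> n [psi [l hn]].
(* The length of the oracle given to the clocked machine, with |phi| replaced by its bound [b a];
   the shifts by 2 are those of [size_spair]. *)
pose L a i := (n + 2) * ((b a i + 2) * (fsize psi i + 2) + 2).
pose T a k := iter m (L a) ((k + 2) ^ l).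
have Lmon a : {homo L a : i j / i <= j}.
  move=> i j le; rewrite leq_mul2l leq_add2r leq_mul ?orbT // leq_add2r.
    exact: b_mono.
  exact: leq_fsize.
exists T => x y u eqa agree.
have clock (z : {phi : Reg A | X phi}) :
    run (umachine U) (npair n (rpair (proj1_sig z) psi)) u
      (T (fsize (proj1_sig z) c) (size u)) = Some (f z u).
  have [q [hq <-]] := hn z.
  apply: run_leq (hq u) _.
  rewrite /T; elim: (m) => //= j IH.
  apply: leq_trans (Lmon _ _ _ IH).
  rewrite [leqLHS]size_spair size_nseq leq_mul2l leq_add2r size_spair.
  by rewrite leq_mul ?orbT // leq_add2r; apply: (bP (proj2_sig z)).
have := clock x; rewrite (@run_local _ _ _ (npair n (rpair (proj1_sig y) psi))) //.
  by rewrite eqa clock => -[].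
by move=> w le; congr (spair _ (spair _ _)); apply: agree.
Qed.

End LocalModulus.

(** * Machines on four zippers *)

Section Zippers.
Variable A : alphabet.
Notation cell := (option A).

(* The cells left of the head, nearest first, and those from the head on. *)
Definition zipper : Type := seq cell * seq cell.
Definition zaction : Type := cell * move.

(* Trailing blanks are dropped, so that computations can be stated as equations
   between zippers. *)
Definition zcons (x : cell) (r : seq cell) : seq cell :=
  match x, r with None, [::] => [::] | _, _ => x :: r end.
Arguments zcons !x r : simpl nomatch.

Definition zread (z : zipper) : cell := seq.head None z.2.

(** The last case includes [MoveL] at cell 0, where the head stays, as with [.-1] on tapes. *)
Definition zact (xd : zaction) (z : zipper) : zipper :=
  let r := behead z.2 in
  match xd.2, z.1 with
  | MoveL, y :: l => (l, zcons y (zcons xd.1 r))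
  | MoveR, l => (xd.1 :: l, r)
  | _, l => (l, zcons xd.1 r)
  end.

Definition zof (u : str A) : zipper := ([::], map Some u).

Definition zcontent (z : zipper) : str A := content (Tape (catrev z.1 z.2) 0).

(** Comparing cells through [nth] identifies contents up to trailing blanks. *)
Definition represents (t : tape A) (z : zipper) : Prop :=
  Defs.head t = size z.1 /\ nth None (cells t) =1 nth None (catrev z.1 z.2).

Lemma nth_catrev_zcons l x r i :
  nth (None : cell) (catrev l (zcons x r)) i = nth None (catrev l (x :: r)) i.
Proof.
case: x r => [?|] [|??] //; rewrite /zcons !catrevE !nth_cat.
by case: ifP => // _; case: (i - _) => // -[].
Qed.

Lemma nth_catrev_zcons2 l y x r i :
  nth (None : cell) (catrev l (zcons y (zcons x r))) i = nth None (catrev l [:: y, x & r]) i.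
Proof. by rewrite nth_catrev_zcons; apply: (nth_catrev_zcons (y :: l)). Qed.

Lemma represents_read t z : represents t z -> tape_read t = zread z.
Proof.
case=> hd e; rewrite /tape_read hd e catrevE nth_cat size_rev ltnn subnn.
by rewrite /zread nth0.
Qed.

Lemma represents_act t z xd : represents t z -> represents (tape_act xd t) (zact xd z).
Proof.
case: z xd t => [l r] [x d] [s h] [/= -> e].
have eS i : nth None (set_nth None s (size l) x) i = nth None (catrev l (x :: behead r)) i.
  rewrite nth_set_nth /= e !catrevE !nth_cat size_rev.
  case: ltngtP => // [lt|->]; last by rewrite subnn.
  by rewrite -(subnSK lt) /= nth_behead.
case: d; rewrite /represents /zact /=.
- case: l e eS => [|y l] /= e eS; split=> // i; rewrite eS.
    by rewrite (nth_catrev_zcons [::]).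
  by rewrite nth_catrev_zcons2.
- by split=> // i; rewrite eS nth_catrev_zcons.
- by split=> // i; rewrite eS.
Qed.

Lemma represents_of u : represents (tape_of u) (zof u).
Proof. by []. Qed.

Lemma content_nth_Some (t : tape A) u :
  nth None (cells t) =1 nth None (map Some u) -> content t = u.
Proof.
case: t => s h /=; rewrite /content /=.
elim: u s => [|a u IH] [|x s] e //=; have := e 0.
- by move=> /= ->.
- by [].
- by move=> /= ->; rewrite /= IH // => i; apply: (e i.+1).
Qed.

Lemma eq_content (t t' : tape A) :
  nth None (cells t) =1 nth None (cells t') -> content t = content t'.
Proof.
case: t t' => s h [s' h'] /=; rewrite /content /=.
elim: s s' => [|x s IH] [|y s'] //= e; have := e 0 => /=.
- by move=> <-.
- by move=> ->.
- move=> ->; case: y e => //= a e; rewrite (IH s') // => i; exact: (e i.+1).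
Qed.

Lemma represents_content t z : represents t z -> content t = zcontent z.
Proof. by case=> _ e; apply: eq_content. Qed.

Lemma zcontent_left (s : str A) : zcontent (rev (map Some s), [::]) = s.
Proof. by apply: content_nth_Some => i; rewrite /= catrevE revK cats0. Qed.

End Zippers.

Section ZipperMachines.
Variables (A : alphabet) (Q : finType) (q0 : Q) (fin : pred Q) (query : Q -> option Q).
Notation cell := (option A).

(* The letters read, and the actions made, on the input-output, query, answer
   and work tape. *)
Variable table : Q -> cell -> cell -> cell -> cell ->
  Q * (zaction A * zaction A * zaction A * zaction A).

Definition zmachine : machine A :=
  @Machine A 1 Q q0 fin query (fun q g =>
    let: (q', (a0, a1, a2, a3)) :=
      table q (g (io_tape _)) (g (query_tape _)) (g (answer_tape _)) (g ord_max) in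
    (q', fun i : 'I_4 => nth a3 [:: a0; a1; a2] i)).

Definition zconfig : Type := Q * (zipper A * zipper A * zipper A * zipper A).

Definition zstep (phi : str A -> str A) (c : zconfig) : zconfig :=
  let: (q, (z0, z1, z2, z3)) := c in
  if fin q then c
  else if query q is Some q' then
    (q', (z0, ([::], [::]), zof (phi (zcontent z1)), z3))
  else
    let: (q', (a0, a1, a2, a3)) := table q (zread z0) (zread z1) (zread z2) (zread z3) in
    (q', (zact a0 z0, zact a1 z1, zact a2 z2, zact a3 z3)).

Definition zinit (u : str A) : zconfig :=
  (q0, (zof u, ([::], [::]), ([::], [::]), ([::], [::]))).

Definition zrepresents (c : config zmachine) (k : zconfig) : Prop :=
  cstate c = k.1 /\
  forall i, represents (ctape c i) (nth k.2.2 [:: k.2.1.1.1; k.2.1.1.2; k.2.1.2] i).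

Lemma zrepresents_step phi c k :
  zrepresents c k -> zrepresents (@step A zmachine phi c) (zstep phi k).
Proof.
case: k c => q [[[z0 z1] z2] z3] [q' ts] [/= -> h]; rewrite /step.
rewrite /=; case: ifP => // _; case: (query q) => [q''|].
  split=> // i; case: i (h i) => -[|[|[|[|i]]]] lt //= hi.
  by rewrite -(represents_content (h (query_tape _))).
rewrite !ffunE (represents_read (h (io_tape _))) (represents_read (h (query_tape _))).
rewrite (represents_read (h (answer_tape _))) (represents_read (h ord_max)) /=.
case: (table _ _ _ _ _) => q1 [[[a0 a1] a2] a3]; split=> // i.
by case: i (h i) => -[|[|[|[|i]]]] lt //= hi; apply: represents_act.
Qed.

Lemma run_zmachine phi u t q z0 z1 z2 z3 :
  iter t (zstep phi) (zinit u) = (q, (z0, z1, z2, z3)) -> fin q ->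
  run zmachine phi u t = Some (zcontent z0).
Proof.
move=> e finq.
have : zrepresents (iter t (@step A zmachine phi) (init zmachine u)) (iter t (zstep phi) (zinit u)).
  elim: t {e} => [|t IH] /=; last exact: zrepresents_step.
  split=> // i; case: i => -[|[|[|[|i]]]] lt //=; exact: represents_of.
rewrite e /run; case: (iter t _ _) => q' ts [/= -> h].
by rewrite finq -(represents_content (h (io_tape _))).
Qed.

End ZipperMachines.

Section Actions.
Variable A : alphabet.
Notation cell := (option A).

Definition put (x : cell) : zaction A := (x, Stay).
Definition put_left (x : cell) : zaction A := (x, MoveL).
Definition put_right (x : cell) : zaction A := (x, MoveR).

Lemma zact_put (l : seq cell) (u : str A) :
  zact (put (zread (l, map Some u))) (l, map Some u) = (l, map Some u).
Proof. by case: u. Qed.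

End Actions.

(** * Computing |phi|(c) in polynomial time *)

Section SizeMachine.
Variables (A : alphabet) (c : nat).
Notation cell := (option A).

(* [Some (Some i)]: i letters of the query 0^c are written; [Some None]: the head
   runs to the end of the input and then writes the answer behind it; [None]:
   final. *)
Definition size_state : finType := option (option 'I_c.+1).

Definition size_query (q : size_state) : option size_state :=
  if q is Some (Some i) then if i == c :> nat then Some (Some None) else None else None.

Definition size_table (q : size_state) (x y z w : cell) :
    size_state * (zaction A * zaction A * zaction A * zaction A) :=
  match q with
  | Some (Some i) =>
    (Some (Some (inord i.+1)), (put x, put_right (Some (zero A)), put z, put w))
  | Some None =>
    match x, z with
    | Some a, _ => (Some None, (put_right x, put y, put z, put w))
    | None, Some b => (Some None, (put_right z, put y, put_right z, put w))
    | None, None => (None, (put x, put y, put z, put w))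
    end
  | None => (None, (put x, put y, put z, put w))
  end.

(* Appending the answer to the input u makes the output a strictly monotone
   function of |u|, as the values of [Reg] have to be. *)
Definition size_machine : machine A :=
  zmachine (Some (Some ord0)) (fun q : size_state => q == None) size_query size_table.

(** The time consists of [c] steps to write the query, one to ask it, |u| to pass the input,
    [fsize phi c] to append the answer and one to halt. *)
Lemma run_size_machine (phi : str A -> str A) (u : str A) :
  run size_machine phi u (c + size u + fsize phi c + 2) =
  Some (u ++ phi (nseq c (zero A))).
Proof.
set v := phi _; pose f := @zstep A size_state (fun q => q == None) size_query size_table phi.
have count j : j <= c -> iter j f (zinit (Some (Some ord0)) u) =
    (Some (Some (inord j)), (zof u, (nseq j (Some (zero A)), [::]), ([::], [::]), ([::], [::]))).
  elim: j => [_|j IH lt]; first by congr (Some (Some _), _); apply/val_inj; rewrite /= inordK.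
  rewrite iterS IH ?(ltnW lt) // /f /= inordK; last by rewrite ltnS ltnW.
  by rewrite (ltn_eqF lt) /= zact_put.
have ask : iter c.+1 f (zinit (Some (Some ord0)) u) =
    (Some None, (zof u, ([::], [::]), zof v, ([::], [::]))).
  rewrite iterS count // /f /= inordK // eqxx /v.
  have := zcontent_left (nseq c (zero A)); rewrite map_nseq.
  have -> : rev (nseq c (Some (zero A))) = nseq c (Some (zero A)).
    apply: (@eq_from_nth _ None) => [|i]; rewrite size_rev // size_nseq => lt.
    rewrite nth_rev size_nseq // !nth_nseq lt; case: ifP => //; lia.
  by move=> ->.
have skip l : iter (size u) f (Some None, ((l, map Some u), ([::], [::]), zof v, ([::], [::]))) =
    (Some None, ((catrev (map Some u) l, [::]), ([::], [::]), zof v, ([::], [::]))).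
  elim: (u) l => // a s IH l; rewrite [size _]/= iterSr -IH; congr iter.
  by rewrite /f /= zact_put.
have append l l' : iter (size v) f (Some None, ((l, [::]), ([::], [::]), (l', map Some v), ([::], [::]))) =
    (Some None, ((catrev (map Some v) l, [::]), ([::], [::]), (catrev (map Some v) l', [::]), ([::], [::]))).
  elim: (v) l l' => // a s IH l l'; rewrite [size _]/= iterSr -IH; congr iter.
have total : iter (c + size u + fsize phi c + 2) f (zinit (Some (Some ord0)) u) =
    (None, ((catrev (map Some (u ++ v)) [::], [::]), ([::], [::]), (catrev (map Some v) [::], [::]), ([::], [::]))).
  have -> : c + size u + fsize phi c + 2 = 1 + (size v + (size u + c.+1)) by rewrite /fsize -/v; lia.
  rewrite !iterD ask skip append map_cat /=.
  by rewrite !catrevE rev_cat !cats0.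
rewrite (run_zmachine total) //; congr Some; exact: zcontent_left.
Qed.

End SizeMachine.

Section LocallyUniform.
Variables (A : alphabet) (X : Reg A -> Prop) (f : {phi : Reg A | X phi} -> Reg A).

Section Append.
Variable v : str A.

Fact append_regular (u w : str A) : size u <= size w -> size (u ++ v) <= size (w ++ v).
Proof. by rewrite !size_cat leq_add2r. Qed.

Fact append_mon i j : i < j -> fsize (cat^~ v) i < fsize (cat^~ v) j.
Proof. by rewrite /fsize !size_cat !size_nseq ltn_add2r. Qed.

Definition append_reg : Reg A := MkReg append_regular append_mon.
End Append.

Lemma modulus_polytime_locally_uc c lam : local_modulus f c lam -> polytime_locally_uc f.
Proof.
move=> lamP; exists (fun _ => True), (fun phi : {phi : Reg A | True} => fsize (proj1_sig phi) c).
split=> // [|n].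
  exists (size_machine A c); split.
    (* Constants are positive, so [c] itself may not be expressible; |phi| is taken at
       [c.+1 + size u] instead, which is larger. *)
    exists (SAdd (SVar) (SAdd (SConst (c + 1)) (SApp (SAdd (SConst c) SVar)))) => phi u.
    have le : c + size u + fsize phi c + 2 <=
      sopoly_eval (SAdd (SVar) (SAdd (SConst (c + 1)) (SApp (SAdd (SConst c) SVar)))) (fsize phi) (size u).
      have /= := @leq_fsize _ phi c (c.+1 + size u); lia.
    by rewrite (run_leq (run_size_machine c phi u) le).
  move=> [phi []] h /=; exists (exist (fun _ => True) (append_reg (phi (nseq c (zero A)))) I).
  split=> [u|]; last by [].
  by exists (c + size u + fsize phi c + 2); apply: run_size_machine.
exists (lam n) => -[phi [hphi [h /= eqn]]] [phi' [hphi' [h' /= eqn']]] u agree.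
apply: lamP => /=; first by rewrite eqn eqn'.
by rewrite eqn.
Qed.

End LocallyUniform.

(** * The dialog machine *)

Section Pairs.
Variable A : alphabet.

(** A mark without its end: after the closing [zero] the second oracle puts a letter telling whether
    the dialog is over. *)
Definition pairs (u : str A) : str A := flatten [seq [:: Defs.one A; a] | a <- u].

Lemma markE (u : str A) : mark u = pairs u ++ [:: zero A; zero A].
Proof. by []. Qed.

Definition code (ss : seq (str A)) : str A := flatten (map (@mark A) ss).

Lemma code_inj : injective code.
Proof.
have mark_cons (u t : str A) : mark u ++ t <> [::].
  by move/(congr1 size); rewrite size_cat size_mark addn2.
elim=> [|u ss IH] [|v ss'] //=.
- by move/esym/mark_cons.
- by move/mark_cons.
- by case/mark_cat_inj => -> /IH ->.
Qed.

End Pairs.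

(* The dialog machine keeps on its work tape a blank followed by the transcript
   t = mark w ++ mark v0 ++ ... of the input w and the values v0, ... of the first
   oracle obtained so far.  A round sends the query rev t (Back, Forth, Ask), skips
   the value of the first oracle (Skip), and reads x from the value of the second,
   which is of the form pairs x ++ [:: zero; h] ++ _ (Read); x is written on the
   output tape as well as on the query tape.  Then the machine halts if h = one,
   and otherwise sends the query x and appends the value of the first oracle to the
   transcript (AskNext, Copy).  The output tape is cleared again during Back: since t
   is longer than x, its head is then back at cell 0. *)
Inductive dialog_state : Type :=
| Init | InA | InB | CopyA | CopyB | Close | Back | Forth | Ask | SkipA | SkipB | SkipZ
| ReadA | ReadB | ReadC | ReadD | ReadE | ReadF | AskNext | Halt.

Definition dialog_states : seq dialog_state :=
  [:: Init; InA; InB; CopyA; CopyB; Close; Back; Forth; Ask; SkipA; SkipB; SkipZ;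
      ReadA; ReadB; ReadC; ReadD; ReadE; ReadF; AskNext; Halt].

Definition dialog_state_index (q : dialog_state) : nat :=
  match q with
  | Init => 0 | InA => 1 | InB => 2 | CopyA => 3 | CopyB => 4 | Close => 5 | Back => 6
  | Forth => 7 | Ask => 8 | SkipA => 9 | SkipB => 10 | SkipZ => 11 | ReadA => 12
  | ReadB => 13 | ReadC => 14 | ReadD => 15 | ReadE => 16 | ReadF => 17 | AskNext => 18
  | Halt => 19
  end.

Lemma dialog_state_indexK : cancel dialog_state_index (nth Init dialog_states).
Proof. by case. Qed.

HB.instance Definition _ := Countable.copy dialog_state (can_type dialog_state_indexK).

Lemma dialog_states_enum : Finite.axiom dialog_states.
Proof. by case. Qed.

HB.instance Definition _ := isFinite.Build dialog_state dialog_states_enum.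

Section Dialog.
Variable A : alphabet.
Notation cell := (option A).

Definition dialog_query (q : dialog_state) : option dialog_state :=
  match q with Ask => Some SkipA | AskNext => Some CopyA | _ => None end.

Definition dialog_table (q : dialog_state) (x y z w : cell) :
    dialog_state * (zaction A * zaction A * zaction A * zaction A) :=
  let kx := put x in let ky := put y in let kz := put z in let kw := put w in
  let o := Some (zero A) in let i := Some (Defs.one A) in
  match q with
  | Init => (InA, (kx, ky, kz, put_right None))
  | InA => if x is Some _ then (InB, (kx, ky, kz, put_right i))
           else (Close, (kx, ky, kz, put_right o))
  | InB => (InA, (put_right x, ky, kz, put_right x))
  | CopyA => if z == i then (CopyB, (kx, ky, put_right z, put_right i))
             else (Close, (kx, ky, put_right z, put_right o))
  | CopyB => (CopyA, (kx, ky, put_right z, put_right z))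
  | Close => (Back, (kx, ky, kz, put o))
  | Back => if w is Some _ then (Back, (put_left None, put_right w, kz, put_left w))
            else (Forth, (kx, ky, kz, put_right w))
  | Forth => if w is Some _ then (Forth, (kx, ky, kz, put_right w))
             else (Ask, (kx, ky, kz, kw))
  | SkipA => (if z == i then SkipB else SkipZ, (kx, ky, put_right z, kw))
  | SkipB => (SkipA, (kx, ky, put_right z, kw))
  | SkipZ => (ReadA, (kx, ky, put_right z, kw))
  | ReadA => (ReadB, (kx, ky, put_right z, kw))
  | ReadB => (if z == i then ReadC else ReadE, (kx, ky, put_right z, kw))
  | ReadC => (ReadD, (kx, ky, put_right z, kw))
  | ReadD => (ReadA, (put_right z, put_right z, put_right z, kw))
  | ReadE => (ReadF, (kx, ky, put_right z, kw))
  | ReadF => (if z == i then Halt else AskNext, (kx, ky, put_right z, kw))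
  | Ask | AskNext | Halt => (q, (kx, ky, kz, kw))
  end.

Definition dialog : machine A :=
  zmachine Init (pred1 Halt) dialog_query dialog_table.

Variables phi psi : Reg A.
Let f := @zstep A dialog_state (pred1 Halt) dialog_query dialog_table (rpair phi psi).
Let e : zipper A := ([::], [::]).
Let S (u : str A) := map Some u.

Let zero_one : (Some (zero A) == Some (Defs.one A)) = false.
Proof. by apply: negbTE; apply: contra (zero_neq_one A) => /eqP[->]. Qed.

(** The last [zero] of the transcript is still missing; [Close] writes it, here as well as after
    each copy phase, so that all rounds start alike. *)
Lemma dialog_input (w : str A) :
  iter (2 * size w + 2) f (zinit Init w) =
  (Close, ((catrev (S w) [::], [::]), e, e, (catrev (S (pairs w ++ [:: zero A])) [:: None], [::]))).
Proof.
have loop l l' : iter (size w).*2 f (InA, ((l, S w), e, e, (l', [::]))) =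
    (InA, ((catrev (S w) l, [::]), e, e, (catrev (S (pairs w)) l', [::]))).
  elim: w l l' => // a w IH l l'.
  rewrite [size _]/= doubleS 2!iterSr -IH; congr iter.
have -> : 2 * size w + 2 = 1 + ((size w).*2 + 1) by lia.
rewrite !iterD.
have -> : iter 1 f (zinit Init w) = (InA, (zof w, e, e, ([:: None], [::]))).
  by rewrite /= /f /= zact_put.
rewrite loop /= /f /= /S map_cat.
by rewrite !catrevE rev_cat.
Qed.

Definition zerase (z : zipper A) : zipper A := zact (put_left None) z.

Lemma iter_zerase (l : seq cell) n : size l < n -> iter n zerase (l, [::]) = ([::], [::]).
Proof.
suff blank m (r : seq cell) : size r <= 1 -> iter ((size l).+1 + m) zerase (l, r) = ([::], [::]).
  by move=> /subnKC <-; apply: blank.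
elim: l r => [|x l IH] r ler; rewrite [size _]/= addSn iterSr.
  have -> : zerase ([::], r) = ([::], [::]) by case: r ler => [|? []].
  by elim: m => //= m ->.
rewrite -(IH (zcons x [::])) //; last by case: x.
by case: r ler => [|? []].
Qed.

(** Reading the transcript leftwards while writing the query rightwards reverses it. The [Back]
    phase lasts long enough to erase the output tape because [l] is no longer than [s]. *)
Lemma dialog_query_phase (l l' : seq cell) (u s : str A) :
  size l <= size s ->
  iter (2 * size s + 5) f
    (Close, ((l, [::]), e, (l', S u), (catrev (S s) [:: None], [::]))) =
  (Ask, (e, (S (rcons s (zero A)), [::]), (l', S u),
         (catrev (S (rcons s (zero A))) [:: None], [::]))).
Proof.
move=> ls.
have back t y r lq (io : zipper A) : iter (size t).+1 f
      (Back, (io, (lq, [::]), (l', S u), (S t ++ [:: None], S (y :: r)))) =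
    (Back, (iter (size t).+1 zerase io, (catrev (S (y :: t)) lq, [::]), (l', S u),
            ([::], None :: S (catrev t (y :: r))))).
  elim: t y r lq io => [|a t IH] y r lq io; first by rewrite /= /f /= zact_put.
  rewrite [size _]/= iterSr [RHS](_ : _ = iter (size t).+1 f
      (Back, (zerase io, (Some y :: lq, [::]), (l', S u), (S t ++ [:: None], S (a :: y :: r))))).
    by congr iter; rewrite /f /= zact_put.
  by rewrite IH -iterSr.
have forth l0 t : iter (size t) f (Forth, (e, (S (rcons s (zero A)), [::]), (l', S u), (l0, S t))) =
    (Forth, (e, (S (rcons s (zero A)), [::]), (l', S u), (catrev (S t) l0, [::]))).
  elim: t l0 => // a t IH l0; rewrite [size _]/= iterSr -IH; congr iter.
  by rewrite /f /= zact_put.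
have -> : 2 * size s + 5 = 1 + (size (rcons s (zero A)) + (1 + ((size (rev s)).+1 + 1))).
  by rewrite size_rcons size_rev; lia.
have start : iter 1 f (Close, ((l, [::]), e, (l', S u), (catrev (S s) [:: None], [::]))) =
    (Back, ((l, [::]), e, (l', S u), (S (rev s) ++ [:: None], S [:: zero A]))).
  by rewrite /= /f /= zact_put /S map_rev catrevE.
rewrite !iterD start back iter_zerase ?size_rev //.
have -> : catrev (S (zero A :: rev s)) [::] = S (rcons s (zero A)).
  by rewrite catrevE cats0 /S -map_rev rev_cons revK.
rewrite catrevE revK cats1.
have turn : iter 1 f (Back, (e, (S (rcons s (zero A)), [::]), (l', S u), ([::], None :: S (rcons s (zero A))))) =
   (Forth, (e, (S (rcons s (zero A)), [::]), (l', S u), ([:: None], S (rcons s (zero A))))).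
  by rewrite /= /f /= zact_put.
by rewrite turn forth /= /f /= zact_put.
Qed.

(** The reply is marked once by the oracle and once more by the pairing, whence four letters on the
    answer tape for each letter of [x]. *)
Lemma dialog_answer_phase (lw l0 : seq cell) (an : zipper A) (q x p : str A) (h : A) :
  psi q = pairs x ++ [:: zero A, h & p] -> zcontent (l0, [::]) = q ->
  exists (l' : seq cell) (u : str A),
  iter (2 * size (phi q) + 4 * size x + 7) f
    (Ask, (e, (l0, [::]), an, (lw, [::]))) =
  (if h == Defs.one A then Halt else AskNext,
   ((catrev (S x) [::], [::]), (catrev (S x) [::], [::]), (l', S u), (lw, [::]))).
Proof.
move=> psiq hq.
have skip u t l : iter (size u).*2.+1 f (SkipA, (e, e, (l, S (pairs u ++ zero A :: t)), (lw, [::]))) =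
    (SkipZ, (e, e, (catrev (S (pairs u ++ [:: zero A])) l, S t), (lw, [::]))).
  elim: u l => [|a u IH] l; first by rewrite /= /f /= zero_one.
  by rewrite [size _]/= doubleS 2!iterSr [RHS]/= -IH; congr iter; rewrite /f /= eqxx.
have read u s t k0 k1 l : iter (size u).*2.*2 f
      (ReadA, ((k0, [::]), (k1, [::]), (l, S (pairs (pairs u ++ s) ++ t)), (lw, [::]))) =
    (ReadA, ((catrev (S u) k0, [::]), (catrev (S u) k1, [::]),
             (catrev (S (pairs (pairs u))) l, S (pairs s ++ t)), (lw, [::]))).
  elim: u k0 k1 l => [|a u IH] k0 k1 l //.
  by rewrite [size _]/= 2!doubleS 4!iterSr [RHS]/= -IH; congr iter; rewrite /f /= eqxx.
set v := phi q; set t := nseq (size v * size (psi q)) (zero A).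
pose t' := [:: zero A, zero A & t].
exists (catrev (S (pairs [:: zero A; h])) (catrev (S (pairs (pairs x)))
  (Some (zero A) :: catrev (S (pairs v ++ [:: zero A])) [::]))), (pairs p ++ t').
have -> : 2 * size v + 4 * size x + 7 = 4 + ((size x).*2.*2 + (1 + ((size v).*2.+1 + 1))).
  by rewrite -!muln2; lia.
have ask : iter 1 f (Ask, (e, (l0, [::]), an, (lw, [::]))) =
    (SkipA, (e, e, ([::], S (pairs v ++ zero A :: zero A :: pairs (pairs x ++ [:: zero A, h & p]) ++ t')), (lw, [::]))).
  by rewrite /= hq -/v /spair !markE /t' /t psiq -!catA.
have enter l u : iter 1 f (SkipZ, (e, e, (l, S (zero A :: u)), (lw, [::]))) =
    (ReadA, (e, e, (Some (zero A) :: l, S u), (lw, [::]))) by [].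
rewrite iterD (iterD (size x).*2.*2) (iterD 1) (iterD _ 1) ask skip enter read.
by rewrite /= /f /= zero_one /= -[zread _ == _]/(h == Defs.one A); case: (h == _).
Qed.

(** The value of [phi] comes first in the pair, so [psi x] is never read and its length does not
    affect the time. *)
Lemma dialog_copy_phase (l : seq cell) (lq lw : seq cell) (an : zipper A) (x : str A) :
  zcontent (lq, [::]) = x ->
  exists (l' : seq cell) (u : str A),
  iter (2 * size (phi x) + 2) f (AskNext, ((l, [::]), (lq, [::]), an, (lw, [::]))) =
  (Close, ((l, [::]), e, (l', S u), (catrev (S (pairs (phi x) ++ [:: zero A])) lw, [::]))).
Proof.
move=> hx.
have copy u t l0 l1 : iter (size u).*2.+1 f
      (CopyA, ((l, [::]), e, (l0, S (pairs u ++ zero A :: t)), (l1, [::]))) =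
    (Close, ((l, [::]), e, (catrev (S (pairs u ++ [:: zero A])) l0, S t),
             (catrev (S (pairs u ++ [:: zero A])) l1, [::]))).
  elim: u l0 l1 => [|a u IH] l0 l1; first by rewrite /= /f /= zero_one.
  rewrite [size _]/= doubleS 2!iterSr.
  by rewrite [RHS]/= -IH; congr iter; rewrite /f /= eqxx.
set v := phi x; set t := zero A :: mark (psi x) ++ nseq (size v * size (psi x)) (zero A).
exists (catrev (S (pairs v ++ [:: zero A])) [::]), t.
have -> : 2 * size v + 2 = (size v).*2.+1 + 1 by lia.
rewrite iterD -copy; congr iter.
by rewrite /= hx /spair markE -catA.
Qed.

Lemma dialog_round (l l' : seq cell) (u s t x p : str A) (h : A) :
  rcons s (zero A) = t -> size l <= size s ->
  psi (rev t) = pairs x ++ [:: zero A, h & p] ->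
  exists (l2 : seq cell) (u2 : str A),
  iter (2 * size t + 2 * fsize phi (size t) + 4 * size x + 10) f
    (Close, ((l, [::]), e, (l', S u), (catrev (S s) [:: None], [::]))) =
  (if h == Defs.one A then Halt else AskNext,
   ((catrev (S x) [::], [::]), (catrev (S x) [::], [::]), (l2, S u2),
    (catrev (S t) [:: None], [::]))).
Proof.
move=> st ls hpsi.
have ht : zcontent (S t, [::]) = rev t.
  by rewrite -[RHS]zcontent_left /S map_rev revK.
have [l2 [u2 h2]] := dialog_answer_phase (catrev (S t) [:: None]) (l', S u) hpsi ht.
exists l2, u2; rewrite -h2 -st -(dialog_query_phase l' u ls) -iterD; congr iter.
by rewrite size_reg size_rev size_rcons; lia.
Qed.

(** [L] stands for |phi| and [d j] for the length of the j-th probe; [L] is a parameter so that it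
    can later be replaced by the bound [b a]. *)
Definition transcript_size (L d : nat -> nat) (k i : nat) : nat :=
  2 * k + 2 + \sum_(j < i) (2 * L (d j) + 2).

Definition round_time (L : nat -> nat) (n x : nat) : nat := 2 * n + 2 * L n + 4 * x + 10.

Definition dialog_time (L d : nat -> nat) (k i x : nat) : nat :=
  2 * k + 2 +
  \sum_(j < i) (round_time L (transcript_size L d k j) (d j) + (2 * L (d j) + 2)) +
  round_time L (transcript_size L d k i) x.

Definition transcript (w : str A) (xs : nat -> str A) (i : nat) : str A :=
  code (w :: [seq phi (xs j) | j <- iota 0 i]).

Lemma transcriptS w xs i : transcript w xs i.+1 = transcript w xs i ++ mark (phi (xs i)).
Proof. by rewrite /transcript -addn1 iotaD map_cat /code /= map_cat flatten_cat /= cats0 catA. Qed.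

Lemma size_transcript w xs i :
  size (transcript w xs i) = transcript_size (fsize phi) (size \o xs) (size w) i.
Proof.
rewrite /transcript_size; elim: i => [|i IH].
  by rewrite big_ord0 /transcript /code /= cats0 size_mark; lia.
by rewrite big_ord_recr transcriptS size_cat IH size_mark size_reg /=; lia.
Qed.

Lemma run_dialog (w v : str A) (xs : nat -> str A) (r : nat) :
  (forall i, i < r -> exists p,
     psi (rev (transcript w xs i)) = pairs (xs i) ++ [:: zero A, zero A & p]) ->
  (exists p, psi (rev (transcript w xs r)) = pairs v ++ [:: zero A, Defs.one A & p]) ->
  run dialog (rpair phi psi) w
    (dialog_time (fsize phi) (size \o xs) (size w) r (size v)) = Some v.
Proof.
move=> ask [p answer].
have rounds i : i <= r -> exists s l l' u,
    [/\ rcons s (zero A) = transcript w xs i, size l <= size s &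
    iter (2 * size w + 2 + \sum_(j < i) (round_time (fsize phi)
       (transcript_size (fsize phi) (size \o xs) (size w) j) (size (xs j)) +
       (2 * fsize phi (size (xs j)) + 2))) f (zinit Init w) =
    (Close, ((l, [::]), e, (l', S u), (catrev (S s) [:: None], [::])))].
  elim: i => [_|i IH lt].
    exists (pairs w ++ [:: zero A]), (catrev (S w) [::]), [::], [::]; split.
    - by rewrite /transcript /code /= cats0 markE rcons_cat.
    - rewrite catrevE cats0 size_rev size_map.
      by have := size_mark w; rewrite markE !size_cat /=; lia.
    - by rewrite big_ord0 addn0 dialog_input.
  have [s [l [l' [u [st ls run_i]]]]] := IH (ltnW lt).
  have [p' psip'] := ask _ lt.
  have [l2 [u2 round]] := dialog_round l' u st ls psip'.
  have hx : zcontent (catrev (S (xs i)) [::], [::]) = xs i by exact: zcontent_left.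
  have [l3 [u3 copy]] := dialog_copy_phase (catrev (S (xs i)) [::])
     (catrev (S (transcript w xs i)) [:: None]) (l2, S u2) hx.
  exists (transcript w xs i ++ pairs (phi (xs i)) ++ [:: zero A]).
  exists (catrev (S (xs i)) [::]), l3, u3; split.
  - by rewrite transcriptS markE !rcons_cat.
  (* The next [Back] phase clears the output tape: [xs i] is no longer than its value under [phi],
     which the transcript now contains. *)
  - have := fsize_ge phi (size (xs i)); rewrite catrevE cats0 size_rev size_map.
    by have := size_mark (phi (xs i)); rewrite -size_reg markE !size_cat /=; lia.
  rewrite big_ord_recr /= addnA addnC iterD run_i addnC iterD /round_time -size_transcript.
  rewrite round; have -> : zero A == Defs.one A = false by exact: zero_one.
  rewrite -size_reg copy; do 2 f_equal.
  by rewrite [in RHS]/S map_cat !catrevE rev_cat catA.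
have [s [l [l' [u [st ls run_r]]]]] := rounds r (leqnn r).
have [l2 [u2 round]] := dialog_round l' u st ls answer.
have stop := round; rewrite eqxx -run_r -iterD addnC size_transcript in stop.
by rewrite (run_zmachine stop) //; congr Some; apply: zcontent_left.
Qed.

End Dialog.

(** * The strategy *)

Section Maxima.
Variables (A : alphabet) (g : str A -> nat).

Definition max_upto (n : nat) : nat := \max_(j < n.+1) \max_(t : j.-tuple A) g t.

Lemma leq_max_upto u n : size u <= n -> g u <= max_upto n.
Proof.
move=> le; apply: leq_trans (leq_bigmax (Ordinal (le : size u < n.+1))).
exact: (leq_bigmax (F := fun t : (size u).-tuple A => g t) (in_tuple u)).
Qed.

Lemma max_upto_mono : {homo max_upto : m n / m <= n}.
Proof.
move=> m n le; apply/bigmax_leqP => j _; apply/bigmax_leqP => t _.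
by apply: leq_max_upto; rewrite size_tuple (leq_trans _ le) // -ltnS.
Qed.

End Maxima.

Lemma leq_transcript_size (L L' d : nat -> nat) k i :
  (forall n, L n <= L' n) -> transcript_size L d k i <= transcript_size L' d k i.
Proof.
by move=> le; rewrite leq_add2l; apply: leq_sum => j _; rewrite leq_add2r leq_mul2l le orbT.
Qed.

Lemma leq_dialog_time (L L' d : nat -> nat) k i x x' :
  (forall n, L n <= L' n) -> {homo L' : m n / m <= n} -> x <= x' ->
  dialog_time L d k i x <= dialog_time L' d k i x'.
Proof.
move=> le mono lex.
have round j y y' : y <= y' -> round_time L (transcript_size L d k j) y <=
    round_time L' (transcript_size L' d k j) y'.
  have lej := leq_transcript_size d k j le.
  by have := leq_trans (le _) (mono _ _ lej); rewrite /round_time; lia.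
rewrite leq_add ?round // leq_add2l; apply: leq_sum => j _.
by rewrite leq_add ?round // leq_add2r leq_mul2l le orbT.
Qed.

Section Strategy.
Variables (A : alphabet) (X : Reg A -> Prop) (f : {phi : Reg A | X phi} -> Reg A).
Variables (c : nat) (lam : nat -> nat -> nat).
Hypothesis lamP : local_modulus f c lam.

(** Probe 0 reveals |phi|(c), on which the number of rounds depends; the later ones enumerate all
    strings. *)
Definition probe (i : nat) : str A :=
  if i is j.+1 then odflt [::] (unpickle j) else nseq c (zero A).

Lemma probeK (u : str A) : probe (pickle (u : seq A)).+1 = u.
Proof. by rewrite /probe pickleK. Qed.

(** One unit of [.+2] accounts for probe 0, the other for the index at which the maximum is
    attained. *)
Definition rounds (a k : nat) : nat := (max_upto (@pickle (seq A)) (lam a k)).+2.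

Definition answers (phi : str A -> str A) (i : nat) : seq (str A) :=
  [seq phi (probe j) | j <- iota 0 i].

(** The oracle need not be computable, so it may choose any element of [X] consistent with the
    values seen; in a dialog about an element of [X], that element is a candidate. *)
Definition verdict (w : str A) (vs : seq (str A)) : str A :=
  if pselect (exists x : {phi : Reg A | X phi}, answers (proj1_sig x) (size vs) = vs)
  is left ex then f (projT1 (cid ex)) w else [::].

(** The chosen [y] agrees with [x] at probe 0, hence has the same |phi|(c), and the other probes
    cover all strings up to the local modulus. *)
Lemma verdict_answers (x : {phi : Reg A | X phi}) w :
  let r := rounds (fsize (proj1_sig x) c) (size w) in
  verdict w (answers (proj1_sig x) r) = f x w.
Proof.
move=> r; rewrite /verdict size_map size_iota.
case: pselect => [ex|[]]; last by exists x.
case: (cid ex) => y /= eqy.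
have agree j : j < r -> proj1_sig y (probe j) = proj1_sig x (probe j).
  move=> lt; have /(congr1 (fun s => nth [::] s j)) := eqy.
  by rewrite !(nth_map 0) ?size_iota // nth_iota.
have eqa : fsize (proj1_sig y) c = fsize (proj1_sig x) c.
  by rewrite /fsize (agree 0).
apply: lamP => // u le; rewrite -[u]probeK; apply: agree; rewrite !ltnS; apply: leq_max_upto.
by rewrite -eqa.
Qed.

(** The first value has length |phi|(c). While there is none, the default is harmless: [rounds] is
    always positive, so probe 0 is sent. *)
Definition instruction (ss : seq (str A)) : str A :=
  if ss is w :: vs then
    if size vs < rounds (size (seq.head [::] vs)) (size w)
    then pairs (probe (size vs)) ++ [:: zero A; zero A]
    else pairs (verdict w vs) ++ [:: zero A; Defs.one A]
  else [::].

Definition strategy (q : str A) : str A :=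
  if pselect (exists ss, rev (code ss) = q) is left ex
  then instruction (projT1 (cid ex)) else [::].

Lemma strategy_code ss : strategy (rev (code ss)) = instruction ss.
Proof.
rewrite /strategy; case: pselect => [ex|[]]; last by exists ss.
by case: (cid ex) => ss' /= /(can_inj revK)/code_inj ->.
Qed.

Lemma strategy_transcript (phi : Reg A) w i :
  let r := rounds (fsize phi c) (size w) in
  strategy (rev (transcript phi w probe i)) =
  if i < r then pairs (probe i) ++ [:: zero A; zero A]
  else pairs (verdict w (answers phi i)) ++ [:: zero A; Defs.one A].
Proof.
by move=> r; rewrite /transcript strategy_code /= size_map size_iota; case: i.
Qed.

Variable growth : nat -> nat.

(** The summands ensure, in this order, strict monotonicity, room for every reply, and domination of
    [growth]. *)
Definition strategy_size (k : nat) : nat :=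
  k + max_upto (fun q => size (strategy q)) k + \sum_(j < k.+1) growth j.

Lemma strategy_size_mono i j : i < j -> strategy_size i < strategy_size j.
Proof.
move=> lt; rewrite -addSn leq_add //.
  by rewrite -addSn leq_add // max_upto_mono // ltnW.
rewrite -!(big_mkord xpredT growth) [leqRHS](@big_cat_nat _ _ _ i.+1) //=.
  exact: leq_addr.
exact: ltnW.
Qed.

(** Regularity requires a length depending on |q| only; the padding follows the reply, where the
    dialog does not look. *)
Definition padded_strategy (q : str A) : str A :=
  strategy q ++ nseq (strategy_size (size q) - size (strategy q)) (zero A).

Lemma size_padded_strategy q : size (padded_strategy q) = strategy_size (size q).
Proof.
rewrite size_cat size_nseq subnKC // (leq_trans _ (leq_addr _ _)) //.
rewrite (leq_trans _ (leq_addl _ _)) //.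
exact: (@leq_max_upto _ (fun q => size (strategy q))).
Qed.

Fact padded_strategy_regular u v :
  size u <= size v -> size (padded_strategy u) <= size (padded_strategy v).
Proof.
rewrite !size_padded_strategy leq_eqVlt => /orP[/eqP->//|lt].
exact/ltnW/strategy_size_mono.
Qed.

Fact padded_strategy_mon i j : i < j -> fsize padded_strategy i < fsize padded_strategy j.
Proof.
by move=> lt; rewrite /fsize !size_padded_strategy !size_nseq strategy_size_mono.
Qed.

Definition strategy_reg : Reg A := MkReg padded_strategy_regular padded_strategy_mon.

Lemma growth_leq_fsize i j : i <= j -> growth i <= fsize strategy_reg j.
Proof.
move=> le; rewrite /fsize size_padded_strategy size_nseq.
rewrite (leq_trans _ (leq_addl _ _)) // (bigD1 (Ordinal (le : i < j.+1))) //=.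
exact: leq_addr.
Qed.

(** The length of [f x w] is bounded by that of the longest unpadded reply to a query as long as the
    last transcript. *)
Lemma run_strategy (x : {phi : Reg A | X phi}) (w : str A) :
  let phi := proj1_sig x in let r := rounds (fsize phi c) (size w) in
  let d := size \o probe in
  run (dialog A) (rpair phi strategy_reg) w
    (dialog_time (fsize phi) d (size w) r
      (max_upto (fun q => size (strategy q)) (transcript_size (fsize phi) d (size w) r)))
  = Some (f x w).
Proof.
move=> phi r d.
have last_round : strategy (rev (transcript phi w probe r)) =
    pairs (f x w) ++ [:: zero A; Defs.one A].
  by rewrite strategy_transcript ltnn verdict_answers.
have := @run_dialog A phi strategy_reg w (f x w) probe r.
move=> /(_ _ _)/run_leq; apply.
- move=> i lt; eexists.
  by rewrite /= /padded_strategy strategy_transcript lt -catA.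
- by eexists; rewrite /= /padded_strategy last_round -catA.
- apply: leq_dialog_time => //; first exact: leq_fsize.
  have := @leq_max_upto A (fun q => size (strategy q)) (rev (transcript phi w probe r)) _ (leqnn _).
  rewrite last_round size_rev size_transcript; apply: leq_trans.
  have := size_mark (f x w); rewrite markE !size_cat /=; lia.
Qed.

End Strategy.

Theorem theorem25 (A : alphabet) (U : universal A) (X : Reg A -> Prop)
    (hX : epb (subspace X)) (f : {phi : Reg A | X phi} -> Reg A) :
  polytime_locally_uc f <-> @in_CT A U 2 (subspace X) (RegSpace A) f.
Proof.
have [c [b [b_mono bP]]] := epb_bound hX.
split=> [/(polytime_locally_uc_modulus b_mono bP)|/(in_CT_modulus b_mono bP)] [lam lamP]; last first.
  exact: modulus_polytime_locally_uc lamP.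
have [n nP] := nth_machine_complete U (dialog A).
pose d := size \o @probe A c.
(* Only the unpadded strategy enters here, so [growth] can be defined from [time] without
   circularity. *)
pose time a k := let r := rounds A lam a k in
  dialog_time (b a) d k r
    (max_upto (fun q => size (strategy f c lam q)) (transcript_size (b a) d k r)).
pose clock a k := uconst U * (n.+1 * (time a k).+1) ^ 2.
pose growth m := \sum_(a < m.+1) \sum_(k < m.+1) clock a k.
(* With exponent [c.+1], the number (|w| + 2)^(c+1) is at least |w| and, being at least 2^(c+1),
   also at least [c]. *)
exists n, (strategy_reg f c lam growth), c.+1 => x.
exists (exist (fun _ => True) (f x) I); split=> // w.
case: x => phi hphi /=; set x := exist _ phi hphi.
set psi := strategy_reg _ _ _ _.
set a := fsize phi c.
have fast : run (dialog A) (rpair phi psi) w (time a (size w)) = Some (f x w).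
  apply: run_leq (run_strategy lamP growth x w) _.
  apply: leq_dialog_time => //; first exact: bP.
  by apply: max_upto_mono; apply: leq_transcript_size; apply: bP.
rewrite -nP in fast.
apply: run_leq (umachine_quadratic fast) _.
set L := fsize (npair n (rpair phi psi)); set K := (size w + 2) ^ c.+1.
have LE i : L i = (n + 2) * ((fsize phi i + 2) * (fsize psi i + 2) + 2).
  by rewrite [LHS]size_spair size_nseq size_spair.
have leK : size w <= K by rewrite (leq_trans _ (leq_pexp2l _ (ltn0Sn c))) ?addn2 // expn1; lia.
have lecK : c <= K.
  by rewrite ltnW // (leq_trans (ltnW (ltn_expl c.+1 (isT : 1 < 2)))) // leq_exp2r // addn2.
have leL i : fsize phi i <= L i /\ fsize psi i <= L i.
  by rewrite LE; split; nia.
have aL : a <= L K by rewrite (leq_trans _ (proj1 (leL K))) // leq_fsize.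
have wL : size w <= L K.
  by rewrite (leq_trans leK) // (leq_trans _ (proj1 (leL K))) // fsize_ge.
(* The outer iterate yields |psi| at [L K]; as [a] and |w| are at most [L K], the required time is a
   summand of [growth (L K)]. *)
apply: leq_trans (proj2 (leL (L K))).
apply: leq_trans (growth_leq_fsize f c lam growth (leqnn (L K))).
rewrite /growth (bigD1 (Ordinal (aL : a < (L K).+1))) //= (leq_trans _ (leq_addr _ _)) //.
rewrite (bigD1 (Ordinal (wL : size w < (L K).+1))) //=.
exact: leq_addr.
Qed.
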